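(* For $n\ge2$ and $d=2$, the set $$A_{n,d}=\{p\in R_{2d}:\mathrm{sp}_r(p)<p_{\min}\ \text{ for all integers } r\ge d\}$$ is not Zariski-closed in $R_{2d}$. (That is, the spectral hierarchy does not have generic finite convergence.)
   Context: $R_{2d}$ is the space of real homogeneous polynomials of degree $2d$ in $x=(x_1,\dots,x_n)$, a finite-dimensional real vector space identified with $\mathbb R^N$; a subset of $\mathbb R^N$ is Zariski-closed if it is the common zero set of finitely many polynomials in $\mathbb R[y_1,\dots,y_N]$. $s=x_1^2+\cdots+x_n^2$; $p_{\min}=\min\{p(x):x\in\mathbb R^n,\|x\|_2=1\}$. Let $[n]=\{1,\dots,n\}$. A matrix $A\in\mathbb R^{[n]^d\times[n]^d}$ is maximally symmetric if, viewed as a $2d$-tensor with entries $A_{\underline i,\underline j}$ at position $\underline i\,\underline j\in[n]^{2d}$, it is invariant under all permutations of the $2d$ indices. Every $f\in R_{2d}$ has a unique maximally symmetric matrix $\mathrm{MaxSym}(f)\in\mathbb R^{[n]^d\times[n]^d}$ with $f(x)=\langle\mathrm{MaxSym}(f),(xx^T)^{\otimes d}\rangle$ (trace inner product). Set $Q(p)=\mathrm{MaxSym}(p)$ and $M=\mathrm{MaxSym}(s^d)$. Let $\Pi_r$ be the orthogonal projection of $(\mathbb R^n)^{\otimes r}$ onto the subspace $S^r(\mathbb R^n)$ of symmetric $r$-tensors. For $r\ge d$ set $Q_r(p)=\Pi_r(Q(p)\otimes I_n^{\otimes(r-d)})\Pi_r$ and $M_r=\Pi_r(M\otimes I_n^{\otimes(r-d)})\Pi_r$.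 The spectral bound is $\mathrm{sp}_r(p)=\max\{\nu\in\mathbb R: Q_r(p)-\nu M_r\succeq0\}=\min\{v^TQ_r(p)v: v\in S^r(\mathbb R^n),\,v^TM_rv=1\}$. *)

(* Defs.v *)
From HB Require Import structures.
From mathcomp Require Import all_boot all_order all_algebra all_fingroup.
From mathcomp Require Import boolp classical_sets reals.
From mathcomp Require Import mpoly.

Set Implicit Arguments.
Unset Strict Implicit.
Unset Printing Implicit Defensive.

Import Order.TTheory GRing.Theory Num.Theory.

Local Open Scope ring_scope.

(* Multi-indices in [n]^r; [tdim n r] is n ^ r, the dimension of (R^n)^{(x) r}.
   An r-tensor is a row vector of length [tdim n r], and an element of
   R^{[n]^r x [n]^r} is a square matrix of that size: rows and columns are
   numbered by [enum_rank], and [ival] recovers the multi-index. *)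
Notation midx n r := {ffun 'I_r -> 'I_n}.
Notation tdim n r := #|{: midx n r}|.

Section Tensors.
Variables (R : realType) (n : nat).

Definition ival r (a : 'I_(tdim n r)) : midx n r := enum_val a.

Definition entry r (A : 'M[R]_(tdim n r)) (i j : midx n r) : R :=
  A (enum_rank i) (enum_rank j).

Definition midx_perm r (s : 'S_r) (i : midx n r) : midx n r :=
  [ffun k => i (s k)].

Definition midx_cat r1 r2 (i : midx n r1) (j : midx n r2) : midx n (r1 + r2) :=
  [ffun k => match split k with inl a => i a | inr b => j b end].

Definition midx_take d r (hdr : (d <= r)%N) (i : midx n r) : midx n d :=
  [ffun k => i (widen_ord hdr k)].

Definition max_symmetric d (A : 'M[R]_(tdim n d)) : Prop :=
  forall (s : 'S_(d + d)) (i j i' j' : midx n d),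
    midx_cat i' j' = midx_perm s (midx_cat i j) ->
    entry A i' j' = entry A i j.

(* (x x^T)^{(x) d} *)
Definition xxT_tens d (x : 'I_n -> R) : 'M[R]_(tdim n d) :=
  \matrix_(a, b) \prod_(k < d) (x (ival a k) * x (ival b k)).

(* The maximally symmetric matrix representing f.  It exists and is unique when
   f is homogeneous of degree 2d; the default 0 is irrelevant in that case. *)
Definition MaxSym d (f : {mpoly R[n]}) : 'M[R]_(tdim n d) :=
  xget 0 [set A | max_symmetric A /\
                  forall x : 'I_n -> R, f.@[x] = \tr (A^T *m xxT_tens d x)]%classic.

Definition sumsq : {mpoly R[n]} := \sum_(i < n) 'X_i ^+ 2.

Definition perm_op r (s : 'S_r) : 'M[R]_(tdim n r) :=
  \matrix_(a, b) (ival b == midx_perm s (ival a))%:R.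

(* S^r(R^n), as a row space: the r-tensors v with v *m perm_op s = v for all s *)
Definition symtens r : 'M[R]_(tdim n r) :=
  (\bigcap_(s : 'S_r) kermx (perm_op s - 1%:M))%MS.

(* The row space of [kermx U^T] is the orthogonal complement of that of U. *)
Definition orth_proj m (U : 'M[R]_m) : 'M[R]_m := proj_mx U (kermx U^T).

Definition symproj r : 'M[R]_(tdim n r) := orth_proj (symtens r).

(* A (x) I_n^{(x) (r-d)} *)
Definition tens_id d r (hdr : (d <= r)%N) (A : 'M[R]_(tdim n d)) :
    'M[R]_(tdim n r) :=
  \matrix_(a, b)
    (entry A (midx_take hdr (ival a)) (midx_take hdr (ival b)) *
     \prod_(k < r | (d <= k)%N) (ival a k == ival b k)%:R).

Definition lift_sym d r (hdr : (d <= r)%N) (A : 'M[R]_(tdim n d)) :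
    'M[R]_(tdim n r) :=
  symproj r *m tens_id hdr A *m symproj r.

Definition Qr d r (hdr : (d <= r)%N) (p : {mpoly R[n]}) : 'M[R]_(tdim n r) :=
  lift_sym hdr (MaxSym d p).

Definition Mr d r (hdr : (d <= r)%N) : 'M[R]_(tdim n r) :=
  lift_sym hdr (MaxSym d (sumsq ^+ d)).

Definition psd m (A : 'M[R]_m) : Prop :=
  A^T = A /\ forall v : 'rV[R]_m, 0 <= (v *m A *m v^T) 0 0.

(* For n > 0 and p homogeneous of degree 2d, the supremum below and the infimum
   in [pmin] are attained, i.e. they are a maximum and a minimum. *)
Definition sp d r (hdr : (d <= r)%N) (p : {mpoly R[n]}) : R :=
  sup [set nu : R | psd (Qr hdr p - nu *: Mr hdr)]%classic.

Definition norm2 (x : 'I_n -> R) : R := Num.sqrt (\sum_(i < n) x i ^+ 2).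

Definition pmin (p : {mpoly R[n]}) : R :=
  inf [set p.@[x] | x in [set x : 'I_n -> R | norm2 x = 1]]%classic.

(* [dhomog n R k] is identified with R^N, N the number of monomials of degree k
   in n variables, through the coefficients of these monomials. *)
Definition hmonom k : {set 'X_{1..n < k.+1}} :=
  [set m : 'X_{1..n < k.+1} | mdeg m == k]%SET.

Definition hcoord k (p : dhomog n R k) (a : 'I_#|hmonom k|) : R :=
  (p : {mpoly R[n]})@_(enum_val a : 'X_{1..n < k.+1}).

Definition zariski_closed k (A : set (dhomog n R k)) : Prop :=
  exists F : seq {mpoly R[#|hmonom k|]},
    A = [set p | forall f, f \in F -> f.@[hcoord p] = 0]%classic.

Definition sp_never_exact d : set (dhomog n R (2 * d)) :=
  [set p : dhomog n R (2 * d) |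
    forall (r : nat) (hdr : (d <= r)%N), sp hdr p < pmin p]%classic.

End Tensors.

(* Main.v *)
Require Import Defs.
From mathcomp Require Import all_boot all_order all_algebra all_fingroup.
From mathcomp Require Import boolp classical_sets reals.
From mathcomp Require Import mpoly.
From mathcomp Require Import ring lra.

Set Implicit Arguments.
Unset Strict Implicit.
Unset Printing Implicit Defensive.

Import Order.TTheory GRing.Theory Num.Theory.

Local Open Scope ring_scope.

(** Membership in the set of never exact forms is unchanged by scaling the form
    by a positive number, while the zero form is outside, since both its
    spectral bound and its minimum are 0.  A polynomial that vanishes on the
    open ray spanned by a form also vanishes at the end point 0 of the ray
    ([mpoly_ray_eq0]).  Hence the set is not Zariski-closed as soon as it is
    nonempty, and it suffices to exhibit one member together with its positive
    multiples: here p = - t x_i^4 with t > 0, whose minimum on the sphere is - t.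

    The matrix of x_i^4 is the rank one matrix E = (e_i e_i^T)^{(x) 2}
    ([MaxSym_pure_power]), and that of s^2, for s the sum of squares, is the
    average M of the three pairings of four indices ([MaxSym_sumsq2]); both
    identifications rest on uniqueness of the maximally symmetric matrix
    ([MaxSymE]), which is polarization ([symmetric_form_eq0]).  Tensoring with identities and restricting to
    symmetric tensors v, write E(v) and M(v) for the two quadratic forms.  A
    number nu is feasible for p exactly if - t E(v) - nu M(v) >= 0 for every v.

    - Some nu is feasible: the identity and the swap pairings give
      3 M(v) >= 2 |v|^2 >= 2 E(v), so nu = - 3 t / 2 works
      ([pure_power_form_le]).
    - Feasible nu stay away from - t.  If nu = - t were feasible, then M - E
      would be positive semidefinite on symmetric tensors and vanish at
      v = e_i^{(x) r}, so v would lie in its kernel; this forces the Hessian of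
      s^2 - x_i^4 at e_i to vanish, whereas it is positive in the directions
      orthogonal to e_i.
      Quantitatively, moving v = e_i^{(x) r} a little towards
      - (e_i + e_j)^{(x) r} produces a symmetric v with 0 < M(v) < E(v)
      ([exists_pure_power_form_gt]), and every feasible nu is at most
      - t E(v) / M(v) < - t. *)

(** * Multi-indices *)

Lemma midx_catl (n r1 r2 : nat) (i : midx n r1) (j : midx n r2) k :
  midx_cat i j (lshift r2 k) = i k.
Proof. by rewrite ffunE -[lshift r2 k]/(unsplit (inl k)) unsplitK. Qed.

Lemma midx_catr (n r1 r2 : nat) (i : midx n r1) (j : midx n r2) k :
  midx_cat i j (rshift r1 k) = j k.
Proof. by rewrite ffunE -[rshift r1 k]/(unsplit (inr k)) unsplitK. Qed.

Definition midx_left (n r1 r2 : nat) (i : midx n (r1 + r2)) : midx n r1 :=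
  [ffun k => i (lshift r2 k)].

Definition midx_right (n r1 r2 : nat) (i : midx n (r1 + r2)) : midx n r2 :=
  [ffun k => i (rshift r1 k)].

Lemma midx_catKl (n r1 r2 : nat) (i : midx n r1) (j : midx n r2) :
  midx_left (midx_cat i j) = i.
Proof. by apply/ffunP => k; rewrite ffunE midx_catl. Qed.

Lemma midx_catKr (n r1 r2 : nat) (i : midx n r1) (j : midx n r2) :
  midx_right (midx_cat i j) = j.
Proof. by apply/ffunP => k; rewrite ffunE midx_catr. Qed.

Lemma midx_leftrightK (n r1 r2 : nat) (i : midx n (r1 + r2)) :
  midx_cat (midx_left i) (midx_right i) = i.
Proof.
by apply/ffunP => k; rewrite ffunE; case: split_ordP => l ->; rewrite ffunE.
Qed.

Lemma sum_midx_cat (R : realType) (n r1 r2 : nat)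
    (F : midx n (r1 + r2) -> R) :
  \sum_i F i = \sum_(i : midx n r1) \sum_(j : midx n r2) F (midx_cat i j).
Proof.
rewrite pair_big /=.
rewrite (reindex (fun p : midx n r1 * midx n r2 => midx_cat p.1 p.2)) //=.
exists (fun i => (midx_left i, midx_right i)) => [[i j] _ | i _] /=.
  by rewrite midx_catKl midx_catKr.
exact: midx_leftrightK.
Qed.

Lemma prod_midx_cat (R : realType) (n r1 r2 : nat) (x : 'I_n -> R)
    (i : midx n r1) (j : midx n r2) :
  \prod_k x (midx_cat i j k) = (\prod_k x (i k)) * \prod_k x (j k).
Proof.
rewrite big_split_ord; congr (_ * _); apply: eq_bigr => k _.
  by rewrite midx_catl.
by rewrite midx_catr.
Qed.

Lemma sum_ival (R : realType) (n r : nat) (F : midx n r -> R) :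
  \sum_(a < tdim n r) F (ival a) = \sum_i F i.
Proof.
rewrite [RHS](reindex (@enum_val _ (mem {: midx n r}))) //=.
by apply: onW_bij; apply: enum_val_bij.
Qed.

Lemma entry_ival (R : realType) (n r : nat) (A : 'M[R]_(tdim n r)) a b :
  A a b = entry A (ival a) (ival b).
Proof. by rewrite /entry /ival !enum_valK. Qed.

Lemma sum_delta (R : realType) (I : finType) (a : I) (F : I -> R) :
  \sum_b (a == b)%:R * F b = F a.
Proof.
rewrite (bigD1 a) //= eqxx mul1r big1 ?addr0 // => b ba.
by rewrite eq_sym (negPf ba) mul0r.
Qed.

Lemma prod_delta (R : realType) (n r : nat) (i j : midx n r) :
  \prod_k (i k == j k)%:R = (i == j)%:R :> R.
Proof.
have [->|ne] := eqVneq i j; first by rewrite big1 // => k _; rewrite eqxx.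
have [k nk] : exists k, i k != j k.
  apply/existsP; rewrite -negb_forall; apply: contra ne => /forallP e.
  by apply/eqP/ffunP => k; apply/eqP.
by rewrite (bigD1 k) //= (negPf nk) mul0r.
Qed.

Lemma sum_midx_prod (R : realType) (n r : nat) (f : 'I_n -> R) :
  \sum_(i : midx n r) \prod_k f (i k) = (\sum_a f a) ^+ r.
Proof.
rewrite -(bigA_distr_bigA (fun _ : 'I_r => f)) /=.
by rewrite prodr_const card_ord.
Qed.

(** * Uniqueness of the maximally symmetric matrix *)

(** Polarization: evaluate the form at x = sum_l t_l e_(j l) for every sign
    vector t and average against prod_l t_l.  Expanding the product over the slots, a
    choice f of one summand per slot contributes T (j o f), weighted by the
    signed sum c f over t; this weight vanishes unless f hits every l, so only
    permutations survive, and there T (j o f) = T j. *)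
Lemma symmetric_form_eq0 (R : realType) (n m : nat) (T : midx n m -> R) :
  (forall (s : 'S_m) i, T (midx_perm s i) = T i) ->
  (forall x : 'I_n -> R, \sum_i T i * \prod_k x (i k) = 0) ->
  forall j, T j = 0.
Proof.
move=> Tsym T0 j.
pose sg (b : bool) : R := (-1) ^+ b.
pose c (f : {ffun 'I_m -> 'I_m}) : R :=
  \sum_(t : {ffun 'I_m -> bool}) (\prod_k sg (t k)) * \prod_k sg (t (f k)).
have cE f : c f = \prod_l (1 + (-1) ^+ (#|[pred k | f k == l]|).+1).
  have -> : c f = \sum_(t : {ffun 'I_m -> bool})
      \prod_l sg (t l) ^+ (#|[pred k | f k == l]|).+1.
    apply: eq_bigr => t _.
    rewrite [X in _ * X](partition_big f xpredT) //= -big_split /=.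
    apply: eq_bigr => l _; rewrite exprS; congr (_ * _).
    rewrite -prodr_const; apply: eq_big => k; first by rewrite inE.
    by move/eqP->.
  rewrite -(bigA_distr_bigA
    (fun l b => sg b ^+ (#|[pred k | f k == l]|).+1)) /=.
  by apply: eq_bigr => l _; rewrite big_bool /= /sg expr0 expr1n addrC.
(* Nonnegativity and positivity at the identity spare counting the
   permutations: the weights of the surviving terms cannot cancel. *)
have c_ge0 f : 0 <= c f.
  rewrite cE; apply: prodr_ge0 => l _.
  by rewrite -signr_odd; case: (odd _); rewrite ?expr1 ?expr0 ?subrr ?addr_ge0.
have c_id_gt0 : 0 < c (finfun id).
  rewrite cE; apply: prodr_gt0 => l _.
  have -> : #|[pred k | finfun id k == l]| = 1%N.
    by rewrite -(card1 l); apply: eq_card => k; rewrite !inE ffunE.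
  by rewrite expr2 mulrNN mulr1 addr_gt0 ?ltr01.
have Tc (f : {ffun 'I_m -> 'I_m}) : T [ffun k => j (f k)] * c f = T j * c f.
  have [/existsP[l /forallP lf]|] := boolP [exists l, forall k, f k != l].
    suff -> : c f = 0 by rewrite !mulr0.
    rewrite cE (bigD1 l) //= (_ : #|_| = 0%N) ?expr1 ?subrr ?mul0r //.
    by apply: eq_card0 => k; rewrite !inE (negPf (lf k)).
  rewrite negb_exists => /forallP surj.
  have finj : injective f.
    have /imset_injP finj : #|[set f k | k in [set: 'I_m]]| == #|[set: 'I_m]|.
      apply/eqP/eq_card => l; rewrite inE; apply/imsetP.
      have := surj l; rewrite negb_forall => /existsP[k]; rewrite negbK.
      by move/eqP => <-; exists k.
    by move=> k1 k2; apply: finj; rewrite inE.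
  rewrite -[T j in RHS](Tsym (perm finj) j).
  by congr (T _ * _); apply/ffunP => k; rewrite !ffunE permE.
suff : T j * \sum_f c f = 0.
  move/eqP; rewrite mulf_eq0 => /orP[/eqP //|/eqP sc0].
  have : 0 < \sum_f c f.
    rewrite (bigD1 (finfun id)) //= ltr_pwDl //.
    by apply: sumr_ge0 => f _; apply: c_ge0.
  by rewrite sc0 ltxx.
rewrite mulr_sumr; under eq_bigr => f _ do rewrite -Tc.
(* The hypothesis at x = sum_l sg (t l) e_(j l), one slot at a time. *)
have expand (t : {ffun 'I_m -> bool}) :
    \sum_(f : {ffun 'I_m -> 'I_m})
      T [ffun k => j (f k)] * \prod_k sg (t (f k)) = 0.
  rewrite -[RHS](T0 (fun a => \sum_l sg (t l) * (a == j l)%:R)).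
  under [RHS]eq_bigr => i _ do
    rewrite (bigA_distr_bigA (fun k l => sg (t l) * (i k == j l)%:R)) mulr_sumr.
  rewrite exchange_big /=; apply: eq_bigr => f _.
  rewrite -(sum_delta [ffun k => j (f k)]
    (fun i => T i * \prod_k sg (t (f k)))).
  apply: eq_bigr => i _; rewrite mulrCA big_split -prod_delta /=.
  congr (_ * _); rewrite mulrC; congr (_ * _); apply: eq_bigr => k _.
  by rewrite ffunE eq_sym.
under eq_bigr => f _ do rewrite mulr_sumr.
rewrite exchange_big big1 //= => t _.
under eq_bigr => f _ do rewrite mulrCA.
by rewrite -mulr_sumr expand mulr0.
Qed.

Lemma mxtrace_xxT (R : realType) (n d : nat) (A : 'M[R]_(tdim n d)) x :
  \tr (A^T *m xxT_tens d x) =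
  \sum_i \sum_j entry A i j * ((\prod_k x (i k)) * \prod_k x (j k)).
Proof.
rewrite /mxtrace [RHS]exchange_big /= -[RHS]sum_ival; apply: eq_bigr => b _.
rewrite mxE -[RHS]sum_ival; apply: eq_bigr => a _.
by rewrite !mxE big_split /= -entry_ival.
Qed.

(** Turns any maximally symmetric matrix that represents f into the value of
    [MaxSym]: the difference of two such matrices is a symmetric tensor whose
    form vanishes, so polarization applies. *)
Lemma MaxSymE (R : realType) (n d : nat) (f : {mpoly R[n]})
    (A : 'M[R]_(tdim n d)) :
  max_symmetric A -> (forall x, f.@[x] = \tr (A^T *m xxT_tens d x)) ->
  MaxSym d f = A.
Proof.
move=> Asym Af; rewrite /MaxSym; set P := (X in xget _ X).
have [Bsym Bf] : P (xget 0 P) by apply: xgetPex; exists A.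
move: (xget 0 P) Bsym Bf => B Bsym Bf.
pose T (i : midx n (d + d)) : R :=
  entry B (midx_left i) (midx_right i) - entry A (midx_left i) (midx_right i).
have Tcat i j : T (midx_cat i j) = entry B i j - entry A i j.
  by rewrite /T midx_catKl midx_catKr.
have T0 : forall i, T i = 0.
  apply: symmetric_form_eq0 => [s i|x].
    have e : midx_cat (midx_left (midx_perm s i)) (midx_right (midx_perm s i)) =
        midx_perm s (midx_cat (midx_left i) (midx_right i)).
      by rewrite !midx_leftrightK.
    by rewrite /T (Asym _ _ _ _ _ e) (Bsym _ _ _ _ _ e).
  rewrite sum_midx_cat.
  have /eqP := Bf x; rewrite Af eq_sym -subr_eq0 => /eqP.
  rewrite !mxtrace_xxT -sumrB => fBA; rewrite -[RHS]fBA; apply: eq_bigr => i _.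
  rewrite -sumrB; apply: eq_bigr => j _.
  by rewrite Tcat prod_midx_cat mulrBl.
apply/matrixP => a b; apply/eqP; rewrite -subr_eq0 !entry_ival.
by rewrite -Tcat T0.
Qed.

(** * Orthogonal projections *)

Lemma row_form (R : realType) (m : nat) (v w : 'rV[R]_m) (A : 'M[R]_m) :
  (v *m A *m w^T) 0 0 = \sum_a \sum_b v 0 a * A a b * w 0 b.
Proof.
rewrite mxE exchange_big /=; apply: eq_bigr => b _.
by rewrite !mxE mulr_suml.
Qed.

Lemma row_normsq_eq0 (R : realType) (m : nat) (v : 'rV[R]_m) :
  (v *m v^T) 0 0 = 0 -> v = 0.
Proof.
rewrite mxE => /psumr_eq0P v0; apply/rowP => a; rewrite mxE.
have := v0 _ a isT; rewrite !mxE => vv.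
suff : v 0 a ^+ 2 = 0 by move/eqP; rewrite sqrf_eq0 => /eqP.
by rewrite expr2 vv // => b _; rewrite mxE -expr2 sqr_ge0.
Qed.

(** This is where the real coefficients enter: a vector orthogonal to itself is
    zero. *)
Lemma orth_cap0 (R : realType) (m : nat) (U : 'M[R]_m) :
  (U :&: kermx U^T)%MS = 0.
Proof.
apply/eqP/rowV0P => v; rewrite sub_capmx => /andP[/submxP[w vE] /sub_kermxP vU].
by apply: row_normsq_eq0; rewrite {2}vE trmx_mul mulmxA vU mul0mx mxE.
Qed.

Lemma orth_full (R : realType) (m k : nat) (U : 'M[R]_m) (W : 'M[R]_(k, m)) :
  (W <= U + kermx U^T)%MS.
Proof.
apply: submx_full; rewrite /row_full mxrank_disjoint_sum ?orth_cap0 //.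
by rewrite mxrank_ker mxrank_tr subnKC ?rank_leq_row.
Qed.

Lemma orth_proj_id (R : realType) (m k : nat) (U : 'M[R]_m) (W : 'M[R]_(k, m)) :
  (W <= U)%MS -> W *m orth_proj U = W.
Proof. by move=> WU; rewrite /orth_proj proj_mx_id ?orth_cap0. Qed.

(** With P the projection, the rows of P lie in U and those of 1 - P are
    orthogonal to U, so (1 - P) P^T = 0, whence P^T = P P^T is symmetric. *)
Lemma orth_proj_tr (R : realType) (m : nat) (U : 'M[R]_m) :
  (orth_proj U)^T = orth_proj U.
Proof.
have PU : (orth_proj U <= U)%MS by rewrite -[orth_proj U]mul1mx proj_mx_sub.
have QK : (1%:M - orth_proj U <= kermx U^T)%MS.
  by rewrite -{1}[orth_proj U]mul1mx proj_mx_compl_sub ?orth_full.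
have PPt : (orth_proj U)^T = orth_proj U *m (orth_proj U)^T.
  have /sub_kermxP QU := QK; have /submxP[D PE] := PU.
  apply/eqP; rewrite -subr_eq0 -{1}[(orth_proj U)^T]mul1mx -mulmxBl.
  by rewrite [X in _ *m X^T]PE trmx_mul mulmxA QU mul0mx.
move: (orth_proj U) PPt => P PPt.
by rewrite -[RHS]trmxK [in RHS]PPt trmx_mul trmxK.
Qed.

(** * Symmetric tensors *)

Definition tens_coord (R : realType) (n r : nat) (v : 'rV[R]_(tdim n r))
  (i : midx n r) : R := v 0 (enum_rank i).

Lemma tensor_form (R : realType) (n r : nat) (v w : 'rV[R]_(tdim n r))
    (A : 'M[R]_(tdim n r)) :
  (v *m A *m w^T) 0 0 =
  \sum_i \sum_j tens_coord v i * entry A i j * tens_coord w j.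
Proof.
rewrite row_form -[RHS]sum_ival; apply: eq_bigr => a _.
rewrite -[RHS]sum_ival; apply: eq_bigr => b _.
by rewrite entry_ival /tens_coord /ival !enum_valK.
Qed.

Lemma midx_perm_inj (n r : nat) (s : 'S_r) :
  injective (@midx_perm n r s).
Proof.
move=> i j /ffunP e; apply/ffunP => k.
by have := e (s^-1%g k); rewrite !ffunE permKV.
Qed.

Lemma perm_opE (R : realType) (n r : nat) (v : 'rV[R]_(tdim n r)) s i :
  tens_coord (v *m perm_op R n s) (midx_perm s i) = tens_coord v i.
Proof.
rewrite /tens_coord mxE (bigD1 (enum_rank i)) //= big1 => [|a nai].
  by rewrite mxE /ival !enum_rankK eqxx mulr1 addr0.
rewrite mxE /ival enum_rankK (inj_eq (@midx_perm_inj _ _ _)).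
by rewrite -[i]enum_rankK (inj_eq enum_val_inj) eq_sym (negPf nai) mulr0.
Qed.

Lemma symtensP (R : realType) (n r : nat) (v : 'rV[R]_(tdim n r)) :
  reflect (forall s i, tens_coord v (midx_perm s i) = tens_coord v i)
          (v <= symtens R n r)%MS.
Proof.
apply: (iffP sub_bigcapmxP) => [vS s i | vS s _].
  have /sub_kermxP := vS s isT; rewrite mulmxBr mulmx1 => /eqP.
  by rewrite subr_eq0 => /eqP vs; rewrite -{1}vs perm_opE.
apply/sub_kermxP/eqP; rewrite mulmxBr mulmx1 subr_eq0; apply/eqP/rowP => b.
have [i ib] : exists i, b = enum_rank (midx_perm s i).
  exists (midx_perm s^-1%g (ival b)); rewrite -[LHS]enum_valK; congr enum_rank.
  by apply/ffunP => k; rewrite !ffunE permK.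
by rewrite ib -!/(tens_coord _ _) perm_opE vS.
Qed.

(** * The quadratic forms of the lifted matrices *)

Lemma midx_take_cat (n d m : nat) (hdr : (d <= d + m)%N)
    (i : midx n d) (j : midx n m) : midx_take hdr (midx_cat i j) = i.
Proof.
apply/ffunP => k; rewrite ffunE -[RHS](midx_catl i j).
by congr (midx_cat _ _ _); apply: val_inj.
Qed.

(** The identity factors force the last m indices on both sides to agree, so the
    form is a sum over those indices of copies of the form of A.  Taking
    r = d + m loses nothing, since d <= r. *)
Lemma tens_id_form (R : realType) (n d m : nat) (hdr : (d <= d + m)%N)
    (A : 'M[R]_(tdim n d)) (v w : 'rV[R]_(tdim n (d + m))) :
  (v *m tens_id hdr A *m w^T) 0 0 =
  \sum_i \sum_i' entry A i i' *
    \sum_(j : midx n m)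
      tens_coord v (midx_cat i j) * tens_coord w (midx_cat i' j).
Proof.
have -> : (v *m tens_id hdr A *m w^T) 0 0 =
    \sum_I \sum_J tens_coord v I * tens_coord w J *
    (entry A (midx_take hdr I) (midx_take hdr J) *
       \prod_(k < d + m | (d <= k)%N) (I k == J k)%:R).
  rewrite tensor_form; apply: eq_bigr => I _; apply: eq_bigr => J _.
  by rewrite mulrAC /entry mxE /ival !enum_rankK.
rewrite sum_midx_cat; apply: eq_bigr => i _.
under eq_bigr => j _ do rewrite sum_midx_cat.
rewrite exchange_big /=; apply: eq_bigr => i' _.
rewrite mulr_sumr; apply: eq_bigr => j _.
have prodE j' : \prod_(k < d + m | (d <= k)%N)
    (midx_cat i j k == midx_cat i' j' k)%:R = (j == j')%:R :> R.
  rewrite big_split_ord /= big_pred0 ?mul1r; last first.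
    by move=> k; rewrite leqNgt ltn_ord.
  under eq_bigl => k do rewrite leq_addr.
  under eq_bigr => k _ do rewrite !midx_catr.
  exact: prod_delta.
rewrite -(sum_delta j (fun j' => entry A i i' *
  (tens_coord v (midx_cat i j) * tens_coord w (midx_cat i' j')))).
by apply: eq_bigr => j' _; rewrite prodE !midx_take_cat; ring.
Qed.

(** The tensor power y^{(x) r}. *)
Definition tpow (R : realType) (n r : nat) (y : 'I_n -> R) : 'rV[R]_(tdim n r) :=
  \row_a \prod_k y (ival a k).

Lemma tcoord_tpow (R : realType) (n r : nat) (y : 'I_n -> R) i :
  tens_coord (tpow r y) i = \prod_k y (i k).
Proof. by rewrite /tens_coord mxE /ival enum_rankK. Qed.

Lemma tpow_sym (R : realType) (n r : nat) (y : 'I_n -> R) :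
  (tpow r y <= symtens R n r)%MS.
Proof.
apply/symtensP => s i; rewrite !tcoord_tpow [RHS](reindex_inj (@perm_inj _ s)).
by apply: eq_bigr => k _; rewrite ffunE.
Qed.

(** On tensor powers the lifted form is the polarized form of A times a power of
    the inner product; this is all that the test vector below requires. *)
Lemma tens_id_tpow (R : realType) (n d m : nat) (hdr : (d <= d + m)%N)
    (A : 'M[R]_(tdim n d)) (y z : 'I_n -> R) :
  (tpow (d + m) y *m tens_id hdr A *m (tpow (d + m) z)^T) 0 0 =
  (tpow d y *m A *m (tpow d z)^T) 0 0 * (\sum_a y a * z a) ^+ m.
Proof.
rewrite tens_id_form tensor_form mulr_suml; apply: eq_bigr => i _.
rewrite mulr_suml; apply: eq_bigr => i' _.
rewrite -sum_midx_prod [in LHS]mulr_sumr mulr_sumr; apply: eq_bigr => j _.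
by rewrite !tcoord_tpow !prod_midx_cat big_split /=; ring.
Qed.

(** The projection is symmetric, so the compressed form at v is the uncompressed
    form at the projection of v. *)
Lemma lift_form (R : realType) (n d r : nat) (hdr : (d <= r)%N)
    (A : 'M[R]_(tdim n d)) (v : 'rV[R]_(tdim n r)) :
  (v *m lift_sym hdr A *m v^T) 0 0 =
  ((v *m symproj R n r) *m tens_id hdr A *m (v *m symproj R n r)^T) 0 0.
Proof.
rewrite /lift_sym; have := orth_proj_tr (symtens R n r).
rewrite -/(symproj R n r); move: (symproj R n r) => S St.
by rewrite trmx_mul St !mulmxA.
Qed.

Lemma lift_sym_tr (R : realType) (n d r : nat) (hdr : (d <= r)%N)
    (A : 'M[R]_(tdim n d)) : A^T = A -> (lift_sym hdr A)^T = lift_sym hdr A.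
Proof.
move=> At; rewrite /lift_sym; have := orth_proj_tr (symtens R n r).
rewrite -/(symproj R n r); move: (symproj R n r) => S St.
rewrite !trmx_mul St mulmxA.
congr (_ *m _ *m _); apply/matrixP => a b; rewrite !mxE /entry -{1}At mxE.
by congr (_ * _); apply: eq_bigr => k _; rewrite eq_sym.
Qed.

(** * The matrix of the square of the sum of squares *)

Definition midx2 (n : nat) (a b : 'I_n) : midx n 2 :=
  [ffun k => if k == ord0 then a else b].

Lemma sum_midx2 (R : realType) (n : nat) (F : midx n 2 -> R) :
  \sum_i F i = \sum_a \sum_b F (midx2 a b).
Proof.
rewrite pair_big /= (reindex (fun p : 'I_n * 'I_n => midx2 p.1 p.2)) //=.
exists (fun i => (i ord0, i ord_max)) => [[a b] _ | i _]; first by rewrite !ffunE.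
apply/ffunP => k; rewrite ffunE /=; case: eqP => [->//|k0].
by congr (i _); apply: val_inj; case: k k0 => -[|[|//]] //= ? []; apply: val_inj.
Qed.

(** The isotropic 4-tensor: the average of the three ways to pair up four
    indices. *)
Definition iso4 (R : realType) (n : nat) (a b c e : 'I_n) : R :=
  ((a == b)%:R * (c == e)%:R + (a == c)%:R * (b == e)%:R
    + (a == e)%:R * (b == c)%:R) / 3.

Lemma sum_iso4 (R : realType) (n : nat) (K : 'I_n -> 'I_n -> 'I_n -> 'I_n -> R) :
  \sum_a \sum_b \sum_c \sum_e iso4 R a b c e * K a b c e =
  ((\sum_a \sum_c K a a c c) + (\sum_a \sum_b K a b a b)
     + (\sum_a \sum_b K a b b a)) / 3.
Proof.
have inner a b : \sum_c \sum_e iso4 R a b c e * K a b c e =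
    ((a == b)%:R * (\sum_c K a b c c) + K a b a b + K a b b a) / 3.
  have -> : \sum_c \sum_e iso4 R a b c e * K a b c e =
      \sum_c ((a == b)%:R * K a b c c + (a == c)%:R * K a b c b
               + (b == c)%:R * K a b c a) / 3.
    apply: eq_bigr => c _.
    rewrite -[K a b c c](sum_delta c) -[K a b c b](sum_delta b).
    rewrite -[K a b c a](sum_delta a) !mulr_sumr -!big_split mulr_suml.
    by apply: eq_bigr => e _; rewrite /iso4 /=; ring.
  by rewrite -mulr_suml !big_split /= -mulr_sumr !sum_delta.
under eq_bigr => a _ do under eq_bigr => b _ do rewrite inner.
rewrite -!big_split mulr_suml; apply: eq_bigr => a _ /=.
by rewrite -mulr_suml !big_split /= sum_delta.
Qed.

Definition sumsq2_mx (R : realType) (n : nat) : 'M[R]_(tdim n 2) :=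
  \matrix_(a, b) iso4 R (ival a ord0) (ival a ord_max)
                        (ival b ord0) (ival b ord_max).

Lemma entry_sumsq2 (R : realType) (n : nat) (a b c e : 'I_n) :
  entry (sumsq2_mx R n) (midx2 a b) (midx2 c e) = iso4 R a b c e.
Proof. by rewrite /entry mxE /ival !enum_rankK !ffunE. Qed.

Lemma sumsq2_mx_tr (R : realType) (n : nat) : (sumsq2_mx R n)^T = sumsq2_mx R n.
Proof.
apply/matrixP => a b; rewrite !mxE /iso4.
rewrite (eq_sym (ival b ord0) (ival a ord0)).
rewrite (eq_sym (ival b ord0) (ival a ord_max)).
rewrite (eq_sym (ival b ord_max) (ival a ord0)).
by rewrite (eq_sym (ival b ord_max) (ival a ord_max)); ring.
Qed.

(** A permutation of the four indices permutes the three pairings; the 24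
    permutations are checked one by one on the positions. *)
Lemma sumsq2_mx_sym (R : realType) (n : nat) : max_symmetric (sumsq2_mx R n).
Proof.
move=> s i j i' j' e.
pose g (k : nat) := midx_cat i j (inord k : 'I_4).
have gE (p : 'I_4) : midx_cat i j p = g p by rewrite /g inord_val.
have iE k : i k = g k by rewrite -(midx_catl i j) gE.
have jE k : j k = g (2 + k)%N by rewrite -(midx_catr i j) gE.
have i'E k : i' k = g (s (lshift 2 k)) by rewrite -(midx_catl i' j') e ffunE gE.
have j'E k : j' k = g (s (rshift 2 k)) by rewrite -(midx_catr i' j') e ffunE gE.
rewrite /entry !mxE /ival !enum_rankK !iE !jE !i'E !j'E /=.
(* The positions are turned into natural numbers below 4, so that the case
   analysis can discard the non-injective quadruples by computation. *)
have : uniq [:: s (lshift 2 (ord0 : 'I_2)); s (lshift 2 (ord_max : 'I_2));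
                s (rshift 2 (ord0 : 'I_2)); s (rshift 2 (ord_max : 'I_2))].
  by rewrite -[_ :: _]/(map s [:: _; _; _; _]) (map_inj_uniq perm_inj).
rewrite -(map_inj_uniq val_inj) /=.
move: (s _) (s _) (s _) (s _) => -[p Hp] [q Hq] [u Hu] [t Ht] /=.
rewrite /iso4 => pqut.
pose sy := (eq_sym (g 1%N) (g 0%N), eq_sym (g 2%N) (g 0%N),
  eq_sym (g 3%N) (g 0%N), eq_sym (g 2%N) (g 1%N), eq_sym (g 3%N) (g 1%N),
  eq_sym (g 3%N) (g 2%N)).
case: p Hp pqut => [|[|[|[|//]]]] _; case: q Hq => [|[|[|[|//]]]] _ //;
  case: u Hu => [|[|[|[|//]]]] _ //; case: t Ht => [|[|[|[|//]]]] _ // _;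
  by rewrite !sy; ring.
Qed.

Lemma mxtrace_tpow (R : realType) (n d : nat) (A : 'M[R]_(tdim n d)) x :
  \tr (A^T *m xxT_tens d x) = (tpow d x *m A *m (tpow d x)^T) 0 0.
Proof.
rewrite mxtrace_xxT tensor_form; apply: eq_bigr => i _.
by apply: eq_bigr => j _; rewrite !tcoord_tpow mulrCA mulrA.
Qed.

Lemma tpow_xxT (R : realType) (n d : nat) (c : R) (x y z : 'I_n -> R) :
  (tpow d y *m (c *: xxT_tens d x) *m (tpow d z)^T) 0 0 =
  c * (\sum_a x a * y a) ^+ d * (\sum_a x a * z a) ^+ d.
Proof.
rewrite tensor_form -!sum_midx_prod -mulrA mulr_suml mulr_sumr.
apply: eq_bigr => i _; rewrite !mulr_sumr; apply: eq_bigr => j _.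
by rewrite !tcoord_tpow /entry !mxE /ival !enum_rankK !big_split /=; ring.
Qed.

Lemma tpow_sumsq2 (R : realType) (n : nat) (y z : 'I_n -> R) :
  (tpow 2 y *m sumsq2_mx R n *m (tpow 2 z)^T) 0 0 =
  ((\sum_a y a ^+ 2) * (\sum_a z a ^+ 2) + 2 * (\sum_a y a * z a) ^+ 2) / 3.
Proof.
have tcoord2 x a b : tens_coord (tpow 2 x) (midx2 a b) = x a * x b :> R.
  by rewrite tcoord_tpow big_ord_recl big_ord1 !ffunE.
transitivity (\sum_a \sum_b \sum_c \sum_e
    iso4 R a b c e * (y a * y b * (z c * z e))).
  rewrite tensor_form sum_midx2; apply: eq_bigr => a _; apply: eq_bigr => b _.
  rewrite sum_midx2; apply: eq_bigr => c _; apply: eq_bigr => e _.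
  by rewrite !tcoord2 entry_sumsq2; ring.
rewrite sum_iso4 mulr_natl mulr2n addrA expr2 !mulr_suml.
by congr ((_ + _ + _) / _); apply: eq_bigr => a _; rewrite mulr_sumr;
  apply: eq_bigr => b _; ring.
Qed.

Lemma MaxSym_sumsq2 (R : realType) (n : nat) :
  MaxSym 2 (sumsq R n ^+ 2) = sumsq2_mx R n.
Proof.
apply: MaxSymE => [|x]; first exact: sumsq2_mx_sym.
rewrite mxtrace_tpow tpow_sumsq2 rmorphXn /sumsq rmorph_sum /=.
under eq_bigr => a _ do rewrite rmorphXn /= mevalXU.
by under [X in 2 * X ^+ 2]eq_bigr => a _ do rewrite -expr2; field.
Qed.

(** * The matrix of a pure power *)

Definition basis_vec (R : realType) (n : nat) (i a : 'I_n) : R := (i == a)%:R.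

Lemma sum_basis_vec (R : realType) (n : nat) (i : 'I_n) (f : 'I_n -> R) :
  \sum_a basis_vec R i a * f a = f i.
Proof. exact: sum_delta. Qed.

Lemma MaxSym_pure_power (R : realType) (n d : nat) (c : R) (i : 'I_n) :
  MaxSym d (c *: 'X_i ^+ (d + d)) = c *: xxT_tens d (basis_vec R i).
Proof.
apply: MaxSymE => [s i1 i2 j1 j2 e|x].
  have E k1 k2 : entry (c *: xxT_tens d (basis_vec R i)) k1 k2 =
      c * \prod_k basis_vec R i (midx_cat k1 k2 k).
    by rewrite /entry !mxE /ival !enum_rankK big_split prod_midx_cat.
  rewrite !E e; congr (_ * _); rewrite [RHS](reindex_inj (@perm_inj _ s)).
  by apply: eq_bigr => k _; rewrite ffunE.
rewrite mxtrace_tpow tpow_xxT sum_basis_vec mevalZ rmorphXn /= mevalXU.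
by rewrite exprD mulrA.
Qed.

(** * Comparison of the two forms on symmetric tensors *)

(** The pairing inside the row index and inside the column index gives a squared
    contraction.  The other two pairings are the identity and the swap of the
    first two slots, and on a symmetric tensor the swap acts as the identity. *)
Lemma form_sumsq2 (R : realType) (n m : nat) (hr : (2 <= 2 + m)%N)
    (v : 'rV[R]_(tdim n (2 + m))) :
  (v <= symtens R n (2 + m))%MS ->
  (v *m tens_id hr (sumsq2_mx R n) *m v^T) 0 0 =
  (\sum_(j : midx n m) ((\sum_a tens_coord v (midx_cat (midx2 a a) j)) ^+ 2
     + 2 * \sum_a \sum_b tens_coord v (midx_cat (midx2 a b) j) ^+ 2)) / 3.
Proof.
move=> /symtensP vS.
pose V a b (j : midx n m) := tens_coord v (midx_cat (midx2 a b) j).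
have Vsym a b j : V b a j = V a b j.
  rewrite -[RHS](vS (tperm (lshift m ord0) (lshift m ord_max))).
  congr tens_coord; apply/ffunP => k; rewrite [RHS]ffunE.
  case: (split_ordP k) => l ->; last first.
    by rewrite tpermD ?midx_catr // -(inj_eq val_inj) /= ltn_eqF // ltn_addr.
  have [->|->] : l = ord0 \/ l = ord_max.
    by case: l => -[|[|//]] hl; [left|right]; apply: val_inj.
    by rewrite tpermL !midx_catl !ffunE.
  by rewrite tpermR !midx_catl !ffunE.
transitivity (\sum_a \sum_b \sum_c \sum_e
    iso4 R a b c e * \sum_j V a b j * V c e j).
  rewrite tens_id_form sum_midx2.
  apply: eq_bigr => a _; apply: eq_bigr => b _.
  rewrite sum_midx2; apply: eq_bigr => c _; apply: eq_bigr => e _.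
  by rewrite entry_sumsq2.
rewrite sum_iso4; congr (_ / _).
rewrite big_split -addrA; congr (_ + _) => /=.
  rewrite (exchange_big_dep xpredT) //=.
  under eq_bigr => c _ do rewrite exchange_big /=.
  rewrite exchange_big /=; apply: eq_bigr => j _.
  rewrite expr2 mulr_suml exchange_big /=; apply: eq_bigr => a _.
  by rewrite mulr_sumr.
rewrite -mulr_sumr mulr_natl mulr2n; congr (_ + _).
  rewrite [RHS]exchange_big; apply: eq_bigr => a _.
  by rewrite [RHS]exchange_big.
rewrite [RHS]exchange_big; apply: eq_bigr => a _.
rewrite [RHS]exchange_big; apply: eq_bigr => b _.
by apply: eq_bigr => j _; rewrite (Vsym a b).
Qed.

Lemma form_pure_power (R : realType) (n d m : nat) (hr : (d <= d + m)%N) (c : R)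
    (i : 'I_n) (v : 'rV[R]_(tdim n (d + m))) :
  (v *m tens_id hr (c *: xxT_tens d (basis_vec R i)) *m v^T) 0 0 =
  c * \sum_(j : midx n m) tens_coord v (midx_cat [ffun=> i] j) ^+ 2.
Proof.
have prodE (k : midx n d) :
    \prod_l basis_vec R i (k l) = ([ffun=> i] == k)%:R.
  by rewrite -prod_delta; apply: eq_bigr => l _; rewrite ffunE.
rewrite tens_id_form.
transitivity (\sum_(k : midx n d) ([ffun=> i] == k)%:R *
    (c * \sum_(k' : midx n d) ([ffun=> i] == k')%:R *
       \sum_j tens_coord v (midx_cat k j) * tens_coord v (midx_cat k' j))).
  apply: eq_bigr => k _; rewrite !mulr_sumr; apply: eq_bigr => k' _.
  by rewrite /entry !mxE /ival !enum_rankK big_split /= !prodE; ring.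
by rewrite !sum_delta.
Qed.

(** After dropping the squared contraction, the right-hand side is twice the
    squared norm of v, and the left-hand side is twice the part of that norm
    carried by the coordinates that start with i, i. *)
Lemma pure_power_form_le (R : realType) (n m : nat) (hr : (2 <= 2 + m)%N)
    (i : 'I_n) (v : 'rV[R]_(tdim n (2 + m))) :
  (v <= symtens R n (2 + m))%MS ->
  2 * (v *m tens_id hr (1 *: xxT_tens 2 (basis_vec R i)) *m v^T) 0 0 <=
  3 * (v *m tens_id hr (sumsq2_mx R n) *m v^T) 0 0.
Proof.
move=> vS; rewrite form_pure_power form_sumsq2 // mul1r mulr_sumr.
rewrite [leRHS]mulrC divfK ?pnatr_eq0 //; apply: ler_sum => j _.
rewrite (_ : [ffun=> i] = midx2 i i); last first.
  by apply/ffunP => k; rewrite !ffunE if_same.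
rewrite -[leLHS]add0r lerD ?sqr_ge0 // ler_pM2l ?ltr0n //.
rewrite (bigD1 i) //= (bigD1 i) //= -addrA lerDl addr_ge0 //.
  by apply: sumr_ge0 => a _; apply: sqr_ge0.
by apply: sumr_ge0 => a _; apply: sumr_ge0 => b _; apply: sqr_ge0.
Qed.

Lemma tens_id_scale (R : realType) (n d r : nat) (hr : (d <= r)%N) (c : R)
    (A : 'M[R]_(tdim n d)) : tens_id hr (c *: A) = c *: tens_id hr A.
Proof. by apply/matrixP => a b; rewrite /tens_id /entry !mxE mulrA. Qed.

Lemma form_subZ (R : realType) (m : nat) (v w : 'rV[R]_m) (A B : 'M[R]_m) c :
  (v *m (A - c *: B) *m w^T) 0 0 =
  (v *m A *m w^T) 0 0 - c * (v *m B *m w^T) 0 0.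
Proof. by rewrite mulmxBr mulmxBl -scalemxAr -scalemxAl !mxE. Qed.

Lemma form_scale (R : realType) (m : nat) (v w : 'rV[R]_m) (A : 'M[R]_m) c :
  (v *m (c *: A) *m w^T) 0 0 = c * (v *m A *m w^T) 0 0.
Proof. by rewrite -scalemxAr -scalemxAl !mxE. Qed.

Lemma form_sub_expand (R : realType) (m : nat) (u w : 'rV[R]_m) (A : 'M[R]_m) c :
  ((u - c *: w) *m A *m (u - c *: w)^T) 0 0 =
  (u *m A *m u^T) 0 0 - c * (u *m A *m w^T) 0 0
   - c * (w *m A *m u^T) 0 0 + c ^+ 2 * (w *m A *m w^T) 0 0.
Proof.
have -> : (u - c *: w)^T = u^T - c *: w^T.
  by apply/matrixP => a b; rewrite !mxE.
rewrite !mulmxBl !mulmxBr -!scalemxAl -!scalemxAr.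
move: (u *m A *m u^T) (u *m A *m w^T) (w *m A *m u^T) (w *m A *m w^T).
by move=> X Y Z T; rewrite !mxE; ring.
Qed.

Lemma xxT_tens_tr (R : realType) (n d : nat) (x : 'I_n -> R) :
  (xxT_tens d x)^T = xxT_tens d x.
Proof.
by apply/matrixP => a b; rewrite !mxE; apply: eq_bigr => k _; rewrite mulrC.
Qed.

(** The test vector is e^{(x) r} - eps (e + e')^{(x) r}, for e and e' the i-th and
    j-th basis vectors.  At e^{(x) r} both forms are 1; to first order in eps they
    become 1 - 8/3 eps for M and 1 - 2 eps for E, because the polarized forms of
    s^2 and x_i^4 at (e, e, e + e', e + e') are 4/3 and 1.  The second order terms
    are 4 * 2^m eps^2 and 2^m eps^2; for eps = 1 / (8 * 2^m) they differ by
    3/8 eps, less than the first order gap 2/3 eps, and M stays positive. *)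
Lemma exists_pure_power_form_gt (R : realType) (n m : nat) (hr : (2 <= 2 + m)%N)
    (i j : 'I_n) : i != j ->
  exists v : 'rV[R]_(tdim n (2 + m)), [/\ (v <= symtens R n (2 + m))%MS,
    0 < (v *m tens_id hr (sumsq2_mx R n) *m v^T) 0 0 &
    (v *m tens_id hr (sumsq2_mx R n) *m v^T) 0 0 <
    (v *m tens_id hr (1 *: xxT_tens 2 (basis_vec R i)) *m v^T) 0 0].
Proof.
move=> ij; pose e := basis_vec R i; pose y a := e a + basis_vec R j a.
pose N : R := 2 ^+ m; have N1 : 1 <= N by rewrite exprn_ege1 // ler1n.
pose eps := (8 * N)^-1.
have eps_gt0 : 0 < eps by rewrite invr_gt0 mulr_gt0 ?ltr0n // (lt_le_trans ltr01).
have epsN : eps * N = 1 / 8.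
  by rewrite /eps; field; rewrite gt_eqF // (lt_le_trans ltr01).
have eps_le : eps <= 1 / 8 by rewrite -epsN ler_peMr // ltW.
exists (tpow (2 + m) e - eps *: tpow (2 + m) y).
(* These values also serve the sums of squares, which are convertible to sums
   of products. *)
have ee : \sum_a e a * e a = 1 by rewrite sum_basis_vec /e /basis_vec eqxx.
have ey : \sum_a e a * y a = 1.
  by rewrite sum_basis_vec /y /e /basis_vec eqxx eq_sym (negPf ij) addr0.
have ye : \sum_a y a * e a = 1 by under eq_bigr do rewrite mulrC.
have yy : \sum_a y a * y a = 2.
  under eq_bigr do rewrite {1}/y mulrDl.
  rewrite big_split /= ey sum_basis_vec.
  by rewrite /y /e /basis_vec eqxx (negPf ij) add0r.
split; first by rewrite addmx_sub ?eqmx_opp ?scalemx_sub ?tpow_sym.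
  rewrite form_sub_expand !tens_id_tpow !tpow_sumsq2 ee ey ye yy.
  rewrite !expr1n -/N.
  rewrite [X in 0 < X](_ : _ = 1 - 8 / 3 * eps + 4 * eps * (eps * N));
    last by field.
  by rewrite epsN; lra.
rewrite !form_sub_expand !tens_id_tpow !tpow_sumsq2 !tpow_xxT -/e.
rewrite ee ey ye yy !expr1n -/N.
rewrite [ltLHS](_ : _ = 1 - 8 / 3 * eps + 4 * eps * (eps * N));
  last by field.
rewrite [ltRHS](_ : _ = 1 - 2 * eps + eps * (eps * N)); last by ring.
by rewrite epsN; lra.
Qed.

(** * The spectral bound and the minimum of a negative fourth power *)

(** The supremum ranges over a nonempty set that is bounded above by
    - t E(v) / M(v) for the test vector v.  Nonemptiness matters, since the
    supremum of the empty set is 0. *)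
Lemma sp_pure_power_lt (R : realType) (n r : nat) (hr : (2 <= r)%N) (i j : 'I_n)
    (t : R) : i != j -> 0 < t -> sp hr (- t *: 'X_i ^+ 4) < - t.
Proof.
move=> ij t_gt0.
have [m rE] : exists m, r = (2 + m)%N by exists (r - 2)%N; rewrite subnKC.
subst r; rewrite /sp; set S := (X in sup X).
pose E (v : 'rV[R]_(tdim n (2 + m))) : R :=
  (v *m tens_id hr (1 *: xxT_tens 2 (basis_vec R i)) *m v^T) 0 0.
pose M (v : 'rV[R]_(tdim n (2 + m))) : R :=
  (v *m tens_id hr (sumsq2_mx R n) *m v^T) 0 0.
have formE nu v : (v *m (Qr hr (- t *: 'X_i ^+ 4) - nu *: Mr R n hr) *m v^T) 0 0 =
    - t * E (v *m symproj R n (2 + m)) - nu * M (v *m symproj R n (2 + m)).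
  rewrite form_subZ /Qr /Mr MaxSym_sumsq2 (@MaxSym_pure_power R n 2) !lift_form.
  by rewrite tens_id_scale form_scale /E scale1r.
have tr nu : (Qr hr (- t *: 'X_i ^+ 4) - nu *: Mr R n hr)^T =
    Qr hr (- t *: 'X_i ^+ 4) - nu *: Mr R n hr.
  rewrite linearB linearZ /= /Qr /Mr MaxSym_sumsq2 (@MaxSym_pure_power R n 2).
  rewrite !lift_sym_tr ?sumsq2_mx_tr //.
  by rewrite linearZ /= xxT_tens_tr.
have S0 : S (- (3 / 2) * t).
  split=> // v; rewrite formE.
  have := @pure_power_form_le R n m hr i (v *m symproj R n (2 + m)).
  rewrite proj_mx_sub => /(_ isT); rewrite -/(E _) -/(M _) => EM.
  rewrite (_ : _ - _ = t * (3 * M (v *m symproj R n (2 + m)) -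
    2 * E (v *m symproj R n (2 + m))) / 2); last by field.
  by rewrite divr_ge0 ?mulr_ge0 ?subr_ge0 // ltW.
have [v [vS M_gt0 ME]] := @exists_pure_power_form_gt R n m hr i j ij.
rewrite -/(M v) in M_gt0 ME; rewrite -/(E v) in ME.
apply: (@le_lt_trans _ _ (- t * E v / M v)); last first.
  by rewrite ltr_pdivrMr // !mulNr ltrN2 ltr_pM2l.
apply: ge_sup => [|nu [_ /(_ v)]]; first by exists (- (3 / 2) * t).
by rewrite formE orth_proj_id // subr_ge0 ler_pdivlMr.
Qed.

Lemma norm2_basis_vec (R : realType) (n : nat) (i : 'I_n) :
  norm2 (basis_vec R i) = 1.
Proof.
rewrite /norm2 (_ : \sum_a _ = 1) ?sqrtr1 //.
under eq_bigr do rewrite expr2.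
by rewrite sum_basis_vec /basis_vec eqxx.
Qed.

Lemma pmin_pure_power_ge (R : realType) (n : nat) (i : 'I_n) (t : R) :
  0 < t -> - t <= pmin (- t *: 'X_i ^+ 4 : {mpoly R[n]}).
Proof.
move=> t_gt0; apply: lb_le_inf.
  by exists (- t *: 'X_i ^+ 4 : {mpoly R[n]}).@[basis_vec R i];
    exists (basis_vec R i) => //; apply: norm2_basis_vec.
move=> _ [x /= x1 <-]; rewrite mevalZ rmorphXn /= mevalXU mulNr lerN2.
have s1 : \sum_a x a ^+ 2 = 1.
  rewrite -[RHS](expr1n _ 2) -x1 /norm2 sqr_sqrtr //.
  by apply: sumr_ge0 => a _; apply: sqr_ge0.
have xi1 : x i ^+ 2 <= 1.
  rewrite -s1 (bigD1 i) //= lerDl.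
  by apply: sumr_ge0 => a _; apply: sqr_ge0.
by rewrite ler_piMr ?(ltW t_gt0) // (exprM _ 2 2) exprn_ile1 ?sqr_ge0.
Qed.

(** * Zariski closedness *)

(** The number 0 is feasible for the zero form, so its spectral bound is at
    least 0; if the feasible set has no supremum the bound is 0 by convention. *)
Lemma zero_notin_sp_never_exact (R : realType) (n d : nat) (i : 'I_n)
    (p : dhomog n R (2 * d)) :
  (p : {mpoly R[n]}) = 0 -> ~ sp_never_exact p.
Proof.
move=> p0 /(_ d (leqnn d)); rewrite p0 => /(le_lt_trans _) lt_pmin.
have pmin0 : pmin (0 : {mpoly R[n]}) <= 0.
  apply: ge_inf; last first.
    by exists (basis_vec R i); [apply: norm2_basis_vec | rewrite meval0].
  by exists 0 => _ [x _ <-]; rewrite meval0.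
have MS0 : MaxSym d (0 : {mpoly R[n]}) = 0.
  apply: MaxSymE => [s i1 i2 j1 j2 _|x]; first by rewrite /entry !mxE.
  by rewrite meval0 trmx0 mul0mx mxtrace0.
suff : 0 < pmin (0 : {mpoly R[n]}) by rewrite ltNge pmin0.
apply: lt_pmin; rewrite /sp; set S := (X in sup X).
have S0 : S 0.
  rewrite /S /= scale0r subr0 /Qr MS0.
  have -> : lift_sym (leqnn d) (0 : 'M[R]_(tdim n d)) = 0.
    rewrite /lift_sym (_ : tens_id _ _ = 0) ?mulmx0 ?mul0mx //.
    by apply/matrixP => a b; rewrite /tens_id /entry !mxE mul0r.
  by split=> [|v]; rewrite ?trmx0 // mulmx0 mul0mx mxE.
have [supS|/sup_out -> //] := pselect (has_sup S).
by apply: ub_le_sup => //; case: supS.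
Qed.

(** Along the ray, f is a univariate polynomial in t, and having infinitely many
    zeros it vanishes at t = 0 as well. *)
Lemma mpoly_ray_eq0 (R : realType) (N : nat) (f : {mpoly R[N]})
    (v : 'I_N -> R) :
  (forall t, 0 < t -> f.@[fun a => t * v a] = 0) -> f.@[fun=> 0] = 0.
Proof.
move=> f0.
pose q : {poly R} := mmap (@polyC R) (fun a => v a *: 'X) f.
have qE t : q.[t] = f.@[fun a => t * v a].
  rewrite /q /mmap mevalE horner_sum; apply: eq_bigr => m _.
  rewrite hornerM hornerC; congr (_ * _); rewrite /mmap1 horner_prod.
  by apply: eq_bigr => a _; rewrite horner_exp hornerZ hornerX mulrC.
have q0 : q = 0.
  apply: (@roots_geq_poly_eq0 _ _ [seq k.+1%:R | k <- iota 0 (size q)]).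
  - by apply/allP => _ /mapP[k _ ->]; rewrite rootE qE f0 ?ltr0n.
  - rewrite map_inj_uniq ?iota_uniq // => k l /eqP.
    by rewrite eqr_nat eqSS => /eqP.
  - by rewrite size_map size_iota.
have := qE 0; rewrite q0 horner0 => e; rewrite [RHS]e; apply: meval_eq => a.
by rewrite mul0r.
Qed.

Theorem theorem5p14 (R : realType) (n : nat) (hn : (2 <= n)%N) :
  ~ zariski_closed (@sp_never_exact R n 2).
Proof.
move=> [F AF].
pose i : 'I_n := Ordinal (ltnW hn); pose j : 'I_n := Ordinal hn.
have p_homog (t : R) :
    (- t *: 'X_i ^+ 4 : {mpoly R[n]}) \is (2 * 2).-homog for mdeg.
  by rewrite rpredZ // mpolyXn dhomogX /= mdegMn mdeg1.
pose p t := DHomog (p_homog t).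
have pA t : 0 < t -> sp_never_exact (p t).
  move=> t_gt0 r hr; apply: lt_le_trans (pmin_pure_power_ge i t_gt0).
  exact: (@sp_pure_power_lt _ _ _ _ i j).
have : sp_never_exact (p 0).
  rewrite AF => f fF.
  have pcoord t : hcoord (p t) = (fun a => t * hcoord (p 1) a).
    by apply/funext => a; rewrite /hcoord /= !mcoeffZ; ring.
  have -> : hcoord (p 0) = fun=> 0.
    by rewrite pcoord; apply/funext => a; rewrite mul0r.
  apply: (@mpoly_ray_eq0 _ _ _ (hcoord (p 1))) => t t_gt0.
  by have := pA t t_gt0; rewrite AF -pcoord => /(_ f fF).
by apply: (zero_notin_sp_never_exact i); rewrite /= oppr0 scale0r.
Qed.
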